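(* Let $M$ be a smooth manifold, $h$ a non-degenerate symmetric $(0,2)$-tensor field and $\nabla$ a torsion-free affine connection on $M$ such that $(M,h,\nabla)$ is a statistical manifold. Let $J:TM\to TM$ be a $(1,1)$-tensor field such that $J$ and $\nabla J$ are $h$-symmetric, let $p,q\in\mathbb{R}$, and let $$\hat J=\begin{pmatrix} -J+pI & (-J^2+pJ+qI)h^{-1}\\ h & J^*\end{pmatrix}$$ be the induced generalized metallic structure on $TM\oplus T^*M$. Then the Nijenhuis tensor field of $\hat J$ with respect to $[\cdot,\cdot]_{\nabla^{(\alpha)}}$ satisfies $$N_{\hat J}^{\nabla^{(\alpha)}}(X+\eta,Y+\beta)=N_{\hat J}^{\nabla}(X+\eta,Y+\beta)$$ for all vector fields $X,Y$, all $1$-forms $\eta,\beta$ and all $\alpha\in\mathbb{R}$. In particular, integrability of $\hat J$ is $\alpha$-invariant: for every $\alpha\in\mathbb{R}$, $N_{\hat J}^{\nabla^{(\alpha)}}=0$ if and only if $N_{\hat J}^{\nabla}=0$.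
   Context: The tensor $h$ is identified with the bundle isomorphism $h:TM\to T^*M$, $h(X)=h(X,\cdot)$, with inverse $h^{-1}$. $(M,h,\nabla)$ is a statistical manifold if $\nabla$ is torsion-free and $(\nabla_Xh)(Y,Z)=(\nabla_Yh)(X,Z)$ for all $X,Y,Z$. $J$ is $h$-symmetric if $h(JX,Y)=h(X,JY)$; $\nabla J$ is $h$-symmetric if $h((\nabla_XJ)Y,Z)=h((\nabla_XJ)Z,Y)$ for all $X,Y,Z$; $(J^*\eta)(X)=\eta(JX)$. The matrix means $\hat J(X+\eta)=-JX+pX+(-J^2+pJ+qI)h^{-1}(\eta)+h(X)+J^*\eta$; it satisfies $\hat J^2=p\hat J+qI$. The dual connection $\nabla^*$ is defined by $X(h(Y,Z))=h(\nabla_XY,Z)+h(Y,\nabla^*_XZ)$, and $\nabla^{(\alpha)}=\frac{1+\alpha}{2}\nabla+\frac{1-\alpha}{2}\nabla^*$. For an affine connection $D$ on $M$ (acting on $1$-forms by $(D_X\beta)(Y)=X(\beta(Y))-\beta(D_XY)$), the bracket is $[X+\eta,Y+\beta]_D=[X,Y]+D_X\beta-D_Y\eta$, and the Nijenhuis tensor of $\hat J$ with respect to $D$ is $N_{\hat J}^{D}(\sigma,\tau)=[\hat J\sigma,\hat J\tau]_D-\hat J[\hat J\sigma,\tau]_D-\hat J[\sigma,\hat J\tau]_D+\hat J^2[\sigma,\tau]_D$. $\hat J$ is integrable with respect to $[\cdot,\cdot]_D$ if $N_{\hat J}^D=0$. *)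

(* Defs.v *)
(* Smooth manifolds are given by smooth atlases.  Following the usual calculus
   of sections, vector fields are the derivations of the algebra C^oo(M), and
   1-forms, (0,2)- and (1,1)-tensor fields are the C^oo(M)-(multi)linear maps
   on vector fields. *)
From HB Require Import structures.
From mathcomp Require Import all_boot all_order all_algebra.
From mathcomp Require Import all_classical all_reals all_analysis.
From mathcomp Require Import ring.

Set Implicit Arguments.
Unset Strict Implicit.
Unset Printing Implicit Defensive.

Import Order.TTheory GRing.Theory Num.Theory.
Import numFieldNormedType.Exports.

Local Open Scope classical_set_scope.
Local Open Scope ring_scope.

Section EuclideanSmoothness.
Context {R : realType} {n : nat} {W : normedModType R}.
Implicit Types (U : set 'rV[R]_n) (f g : 'rV[R]_n -> W).

(* Only meaningful for an open U, outside of which f is arbitrary. *)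
Fixpoint Ck (k : nat) U f : Prop :=
  (forall x, U x -> {for x, continuous f}) /\
  if k is k'.+1 then
    forall v, (forall x, U x -> derivable f x v) /\ Ck k' U ('D_v f)
  else True.

Definition Cinfty U f : Prop := forall k, Ck k U f.

Lemma near_eq_on U f g x : open U -> {in U, f =1 g} -> U x ->
  {near x, f =1 g}.
Proof.
move=> oU fg Ux; have : nbhs x U by exact: open_nbhs_nbhs.
by apply: filterS => y Uy; apply: fg; rewrite inE.
Qed.

Lemma near_eq_continuous f g x : {near x, f =1 g} ->
  {for x, continuous f} -> {for x, continuous g}.
Proof.
move=> fg cf; rewrite /prop_for /continuous_at -(nbhs_singleton fg).
exact: cvg_trans (near_eq_cvg fg) cf.
Qed.

Lemma Ck_eq k U f g : open U -> {in U, f =1 g} -> Ck k U f -> Ck k U g.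
Proof.
move=> oU; elim: k f g => [|k IH] f g fg /= [cf df].
  by split=> // x Ux; exact: near_eq_continuous (near_eq_on oU fg Ux) (cf x Ux).
split=> [x Ux|v].
  exact: near_eq_continuous (near_eq_on oU fg Ux) (cf x Ux).
have [df1 df2] := df v; split=> [x Ux|].
  exact: near_eq_derivable (near_eq_on oU fg Ux) (df1 x Ux).
apply: IH df2 => x; rewrite inE => Ux.
exact: near_eq_derive (near_eq_on oU fg Ux).
Qed.

Lemma CkW k U f : Ck k.+1 U f -> Ck k U f.
Proof.
elim: k f => [|k IH] f [cf df]; split=> // v.
by have [df1 df2] := df v; split=> //; exact: IH.
Qed.

Lemma Ck_cst k U (w : W) : Ck k U (cst w).
Proof.
have cw (v : W) x : {for x, continuous (cst v : 'rV[R]_n -> W)}.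
  exact: cst_continuous.
elim: k w => [|k IH] w /=; split=> // v; split=> [x _|].
  exact: derivable_cst.
by rewrite (_ : 'D_v _ = cst 0) //; apply/funext => x; exact: derive_cst.
Qed.

Lemma CkD k U f g : open U -> Ck k U f -> Ck k U g -> Ck k U (f + g).
Proof.
move=> oU; elim: k f g => [|k IH] f g /= [cf df] [cg dg].
  by split=> // x Ux; apply: continuousD; [exact: cf | exact: cg].
split=> [x Ux|v]; first by apply: continuousD; [exact: cf | exact: cg].
have [df1 df2] := df v; have [dg1 dg2] := dg v; split=> [x Ux|].
  by apply: derivableD; [exact: df1 | exact: dg1].
apply: Ck_eq (IH _ _ df2 dg2) => // x; rewrite inE => Ux.
by rewrite deriveD //; [exact: df1 | exact: dg1].
Qed.

End EuclideanSmoothness.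

Lemma CkM (R : realType) n k (U : set 'rV[R]_n) (f g : 'rV[R]_n -> R) :
  open U -> Ck k U f -> Ck k U g -> Ck k U (f * g).
Proof.
move=> oU; elim: k f g => [|k IH] f g Cf Cg.
  move: Cf Cg => [cf _] [cg _]; split=> // x Ux.
  by apply: continuousM; [exact: cf | exact: cg].
have [Cf' Cg'] := (CkW Cf, CkW Cg); move: Cf Cg => [cf df] [cg dg].
split=> [x Ux|v]; first by apply: continuousM; [exact: cf | exact: cg].
have [df1 df2] := df v; have [dg1 dg2] := dg v; split=> [x Ux|].
  by apply: derivableM; [exact: df1 | exact: dg1].
apply: Ck_eq (CkD oU (IH _ _ Cf' dg2) (IH _ _ Cg' df2)) => // x.
rewrite inE => Ux.
by rewrite deriveM //; [exact: df1 | exact: dg1].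
Qed.

Record chart (R : realType) (n : nat) (T : topologicalType) := Chart {
  chart_dom : set T;
  chart_map :> T -> 'rV[R]_n;
  chart_inv : 'rV[R]_n -> T;
  chart_dom_open : open chart_dom;
  chart_img_open : open (chart_map @` chart_dom);
  chart_mapK : {in chart_dom, cancel chart_map chart_inv};
  chart_map_continuous :
    forall x, chart_dom x -> {for x, continuous chart_map};
  chart_inv_continuous :
    forall u, (chart_map @` chart_dom) u -> {for u, continuous chart_inv}
}.

Record smoothManifold (R : realType) (n : nat) := SmoothManifold {
  manifold_space :> topologicalType;
  atlas : set (chart R n manifold_space);
  manifold_hausdorff : hausdorff_space manifold_space;
  manifold_second_countable : @second_countable manifold_space;
  atlas_cover : forall x, exists2 c, atlas c & chart_dom c x;
  atlas_compatible : forall c d, atlas c -> atlas d ->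
    Cinfty (c @` (chart_dom c `&` chart_dom d)) (d \o chart_inv c)
}.

Definition smooth (R : realType) n (M : smoothManifold R n) (f : M -> R) :=
  forall c, atlas c -> Cinfty (c @` chart_dom c) (f \o chart_inv c).

Section SmoothFunctions.
Context {R : realType} {n : nat} (M : smoothManifold R n).

Record smoothfun := SmoothFun {
  smoothfun_fun :> M -> R;
  smoothfunP : smooth smoothfun_fun
}.

HB.instance Definition _ := gen_eqMixin smoothfun.
HB.instance Definition _ := gen_choiceMixin smoothfun.

Lemma smoothfun_ext (f g : smoothfun) : f =1 g -> f = g.
Proof.
case: f g => [f fP] [g gP] /= /funext fg; case: _ / fg gP => gP.
by congr SmoothFun; exact: Prop_irrelevance.
Qed.

Lemma smooth_cst (a : R) : smooth (fun _ : M => a).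
Proof. by move=> c _ k; exact: (Ck_cst k _ a). Qed.

Lemma smoothD (f g : smoothfun) : smooth (fun x => f x + g x).
Proof.
move=> c ac k.
exact: (CkD (@chart_img_open _ _ _ c) (smoothfunP f ac k) (smoothfunP g ac k)).
Qed.

Lemma smoothM (f g : smoothfun) : smooth (fun x => f x * g x).
Proof.
move=> c ac k.
exact: (CkM (@chart_img_open _ _ _ c) (smoothfunP f ac k) (smoothfunP g ac k)).
Qed.

Definition scst (a : R) := SmoothFun (smooth_cst a).
Definition sadd f g := SmoothFun (smoothD f g).
Definition smul f g := SmoothFun (smoothM f g).
Definition sopp f := smul (scst (- 1)) f.

Fact saddA : associative sadd.
Proof. by move=> f g h; apply: smoothfun_ext => x /=; rewrite addrA. Qed.
Fact saddC : commutative sadd.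
Proof. by move=> f g; apply: smoothfun_ext => x /=; rewrite addrC. Qed.
Fact sadd0 : left_id (scst 0) sadd.
Proof. by move=> f; apply: smoothfun_ext => x /=; rewrite add0r. Qed.
Fact saddN : left_inverse (scst 0) sopp sadd.
Proof. by move=> f; apply: smoothfun_ext => x /=; rewrite mulN1r addNr. Qed.
HB.instance Definition _ :=
  GRing.isZmodule.Build smoothfun saddA saddC sadd0 saddN.

Fact smulA : associative smul.
Proof. by move=> f g h; apply: smoothfun_ext => x /=; rewrite mulrA. Qed.
Fact smulC : commutative smul.
Proof. by move=> f g; apply: smoothfun_ext => x /=; rewrite mulrC. Qed.
Fact smul1 : left_id (scst 1) smul.
Proof. by move=> f; apply: smoothfun_ext => x /=; rewrite mul1r. Qed.
Fact smulDl : left_distributive smul sadd.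
Proof. by move=> f g h; apply: smoothfun_ext => x /=; rewrite mulrDl. Qed.
HB.instance Definition _ :=
  GRing.Zmodule_isComPzRing.Build smoothfun smulA smulC smul1 smulDl.

Definition sscale (a : R) (f : smoothfun) := scst a * f.
Fact sscaleA a b f : sscale a (sscale b f) = sscale (a * b) f.
Proof. by apply: smoothfun_ext => x /=; rewrite mulrA. Qed.
Fact sscale1 : left_id 1 sscale.
Proof. by move=> f; apply: smoothfun_ext => x /=; rewrite mul1r. Qed.
Fact sscaleDr : right_distributive sscale +%R.
Proof. by move=> a f g; apply: smoothfun_ext => x /=; rewrite mulrDr. Qed.
Fact sscaleDl f : {morph sscale^~ f : a b / a + b}.
Proof. by move=> a b; apply: smoothfun_ext => x /=; rewrite mulrDl. Qed.
HB.instance Definition _ := GRing.Zmodule_isLmodule.Build R smoothfun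
  sscaleA sscale1 sscaleDr sscaleDl.

Lemma scst_is_additive : {morph scst : a b / a + b}.
Proof. by move=> a b; exact: smoothfun_ext. Qed.
Lemma scst_is_multiplicative : {morph scst : a b / a * b}.
Proof. by move=> a b; exact: smoothfun_ext. Qed.
Lemma scst1 : scst 1 = 1. Proof. by []. Qed.
Lemma scst0 : scst 0 = 0. Proof. by []. Qed.
Lemma sscaleE (a : R) (f : smoothfun) : a *: f = scst a * f.
Proof. by []. Qed.

End SmoothFunctions.

Section VectorFields.
Context {R : realType} {n : nat} (M : smoothManifold R n).
Local Notation A := (smoothfun M).

Record vfield := VField {
  vfield_fun :> A -> A;
  vfieldL : forall (a : R) f g,
    vfield_fun (a *: f + g) = a *: vfield_fun f + vfield_fun g;
  vfieldM : forall f g, vfield_fun (f * g) = f * vfield_fun g + g * vfield_fun f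
}.

HB.instance Definition _ := gen_eqMixin vfield.
HB.instance Definition _ := gen_choiceMixin vfield.

Lemma vfield_ext (X Y : vfield) : X =1 Y -> X = Y.
Proof.
case: X Y => [X p q] [Y p' q'] /= /funext XY; case: _ / XY p' q' => p' q'.
by congr VField; exact: Prop_irrelevance.
Qed.

Lemma vfieldD (X : vfield) f g : X (f + g) = X f + X g.
Proof. by rewrite -[f]scale1r vfieldL !scale1r. Qed.
Lemma vfield0 (X : vfield) : X 0 = 0.
Proof. by apply: (addrI (X 0)); rewrite -vfieldD !addr0. Qed.
Lemma vfieldZ (X : vfield) (a : R) f : X (a *: f) = a *: X f.
Proof. by rewrite -[a *: f]addr0 vfieldL vfield0 addr0. Qed.
Lemma vfieldN (X : vfield) f : X (- f) = - X f.
Proof. by rewrite -[- f]scaleN1r vfieldZ scaleN1r. Qed.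
Lemma vfieldB (X : vfield) f g : X (f - g) = X f - X g.
Proof. by rewrite vfieldD vfieldN. Qed.

Program Definition vzero := @VField (fun=> 0) _ _.
Next Obligation. by move=> *; rewrite scaler0 addr0. Qed.
Next Obligation. by move=> *; rewrite !mulr0 addr0. Qed.

Program Definition vadd (X Y : vfield) := @VField (fun f => X f + Y f) _ _.
Next Obligation. by move=> X Y a f g /=; rewrite !vfieldL scalerDr addrACA. Qed.
Next Obligation. by move=> X Y f g /=; rewrite !vfieldM !mulrDr addrACA. Qed.

Program Definition vscale (u : A) (X : vfield) :=
  @VField (fun f => u * X f) _ _.
Next Obligation.
by move=> u X a f g /=; rewrite vfieldL mulrDr !sscaleE mulrCA.
Qed.
Next Obligation.
by move=> u X f g /=; rewrite vfieldM mulrDr; congr (_ + _); rewrite mulrCA.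
Qed.

Fact vaddA : associative vadd.
Proof. by move=> X Y Z; apply: vfield_ext => f /=; rewrite addrA. Qed.
Fact vaddC : commutative vadd.
Proof. by move=> X Y; apply: vfield_ext => f /=; rewrite addrC. Qed.
Fact vadd0 : left_id vzero vadd.
Proof. by move=> X; apply: vfield_ext => f /=; rewrite add0r. Qed.
Fact vaddN : left_inverse vzero (vscale (- 1)) vadd.
Proof. by move=> X; apply: vfield_ext => f /=; rewrite mulN1r addNr. Qed.
HB.instance Definition _ :=
  GRing.isZmodule.Build vfield vaddA vaddC vadd0 vaddN.

Fact vscaleA u v X : vscale u (vscale v X) = vscale (u * v) X.
Proof. by apply: vfield_ext => f /=; rewrite mulrA. Qed.
Fact vscale1 : left_id 1 vscale.
Proof. by move=> X; apply: vfield_ext => f /=; rewrite mul1r. Qed.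
Fact vscaleDr : right_distributive vscale +%R.
Proof. by move=> u X Y; apply: vfield_ext => f /=; rewrite mulrDr. Qed.
Fact vscaleDl X : {morph vscale^~ X : u v / u + v}.
Proof. by move=> u v; apply: vfield_ext => f /=; rewrite mulrDl. Qed.
HB.instance Definition _ := GRing.Zmodule_isLmodule.Build A vfield
  vscaleA vscale1 vscaleDr vscaleDl.

Lemma vaddE (X Y : vfield) f : (X + Y) f = X f + Y f. Proof. by []. Qed.
Lemma vscaleE u (X : vfield) f : (u *: X) f = u * X f. Proof. by []. Qed.
Lemma voppE (X : vfield) f : (- X) f = - X f. Proof. exact: mulN1r. Qed.

Program Definition lie_bracket (X Y : vfield) :=
  @VField (fun f => X (Y f) - Y (X f)) _ _.
Next Obligation.
by move=> X Y a f g /=; rewrite !vfieldL scalerBr opprD addrACA.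
Qed.
Next Obligation. by move=> X Y f g /=; rewrite !(vfieldM, vfieldD); ring. Qed.

Record oneform := OneForm {
  oneform_fun :> vfield -> A;
  oneformL : forall u X Y,
    oneform_fun (u *: X + Y) = u * oneform_fun X + oneform_fun Y
}.

HB.instance Definition _ := gen_eqMixin oneform.
HB.instance Definition _ := gen_choiceMixin oneform.

Lemma oneform_ext (e b : oneform) : e =1 b -> e = b.
Proof.
case: e b => [e p] [b p'] /= /funext eb; case: _ / eb p' => p'.
by congr OneForm; exact: Prop_irrelevance.
Qed.

Lemma oneformD (e : oneform) X Y : e (X + Y) = e X + e Y.
Proof. by rewrite -[X]scale1r oneformL mul1r !scale1r. Qed.
Lemma oneform0 (e : oneform) : e 0 = 0.
Proof. by apply: (addrI (e 0)); rewrite -oneformD !addr0. Qed.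
Lemma oneformZ (e : oneform) u X : e (u *: X) = u * e X.
Proof. by rewrite -[u *: X]addr0 oneformL oneform0 addr0. Qed.
Lemma oneformN (e : oneform) X : e (- X) = - e X.
Proof. by rewrite -scaleN1r oneformZ mulN1r. Qed.
Lemma oneformB (e : oneform) X Y : e (X - Y) = e X - e Y.
Proof. by rewrite oneformD oneformN. Qed.

Program Definition ozero := @OneForm (fun=> 0) _.
Next Obligation. by move=> *; rewrite mulr0 addr0. Qed.

Program Definition oadd (e b : oneform) := @OneForm (fun X => e X + b X) _.
Next Obligation. by move=> e b u X Y /=; rewrite !oneformL; ring. Qed.

Program Definition oscale (v : A) (e : oneform) := @OneForm (fun X => v * e X) _.
Next Obligation. by move=> v e u X Y /=; rewrite !oneformL; ring. Qed.

Fact oaddA : associative oadd.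
Proof. by move=> e b c; apply: oneform_ext => X /=; rewrite addrA. Qed.
Fact oaddC : commutative oadd.
Proof. by move=> e b; apply: oneform_ext => X /=; rewrite addrC. Qed.
Fact oadd0 : left_id ozero oadd.
Proof. by move=> e; apply: oneform_ext => X /=; rewrite add0r. Qed.
Fact oaddN : left_inverse ozero (oscale (- 1)) oadd.
Proof. by move=> e; apply: oneform_ext => X /=; rewrite mulN1r addNr. Qed.
HB.instance Definition _ :=
  GRing.isZmodule.Build oneform oaddA oaddC oadd0 oaddN.

Fact oscaleA u v e : oscale u (oscale v e) = oscale (u * v) e.
Proof. by apply: oneform_ext => X /=; rewrite mulrA. Qed.
Fact oscale1 : left_id 1 oscale.
Proof. by move=> e; apply: oneform_ext => X /=; rewrite mul1r. Qed.
Fact oscaleDr : right_distributive oscale +%R.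
Proof. by move=> u e b; apply: oneform_ext => X /=; rewrite mulrDr. Qed.
Fact oscaleDl e : {morph oscale^~ e : u v / u + v}.
Proof. by move=> u v; apply: oneform_ext => X /=; rewrite mulrDl. Qed.
HB.instance Definition _ := GRing.Zmodule_isLmodule.Build A oneform
  oscaleA oscale1 oscaleDr oscaleDl.

Lemma oaddE (e b : oneform) X : (e + b) X = e X + b X. Proof. by []. Qed.
Lemma oscaleE u (e : oneform) X : (u *: e) X = u * e X. Proof. by []. Qed.
Lemma ooppE (e : oneform) X : (- e) X = - e X. Proof. exact: mulN1r. Qed.

End VectorFields.

Section Metric.
Context {R : realType} {n : nat} (M : smoothManifold R n).
Local Notation A := (smoothfun M).
Local Notation XM := (vfield M).

Record tensor02 := Tensor02 {
  tensor02_fun :> XM -> XM -> A;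
  tensor02Ll : forall u X Y Z,
    tensor02_fun (u *: X + Y) Z = u * tensor02_fun X Z + tensor02_fun Y Z;
  tensor02Lr : forall X u Y Z,
    tensor02_fun X (u *: Y + Z) = u * tensor02_fun X Y + tensor02_fun X Z
}.

(* h : TM -> T*M, X |-> h(X, -) *)
Definition flat (h : tensor02) (X : XM) : oneform M := OneForm (tensor02Lr h X).

(* a pseudo-Riemannian metric, of arbitrary signature *)
Record prmetric := PRMetric {
  prmetric_tensor :> tensor02;
  prmetric_sym : forall X Y, prmetric_tensor X Y = prmetric_tensor Y X;
  (* non-degeneracy: h : TM -> T*M is an isomorphism, expressed on sections *)
  prmetric_nondeg : bijective (flat prmetric_tensor)
}.

(* h^-1 : T*M -> TM *)
Definition sharp (h : prmetric) (e : oneform M) : XM :=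
  xget 0 [set X | flat h X = e].

Lemma flatK (h : prmetric) : cancel (flat h) (sharp h).
Proof.
move=> X; apply: xget_unique => //= Y; exact: bij_inj (prmetric_nondeg h) _ _.
Qed.

Lemma sharpK (h : prmetric) : cancel (sharp h) (flat h).
Proof.
move=> e; have [g _ gK] := prmetric_nondeg h.
by rewrite /sharp; case: xgetP => //= /(_ (g e)); rewrite gK.
Qed.

Lemma flatL (h : tensor02) u X Y : flat h (u *: X + Y) = u *: flat h X + flat h Y.
Proof. by apply: oneform_ext => Z /=; rewrite tensor02Ll. Qed.

Lemma sharpL (h : prmetric) u e b : sharp h (u *: e + b) = u *: sharp h e + sharp h b.
Proof.
by apply: (can_inj (flatK h)); rewrite flatL !sharpK.
Qed.

Lemma tensor02Dr (h : tensor02) X Y Z : h X (Y + Z) = h X Y + h X Z.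
Proof. exact: (oneformD (flat h X)). Qed.
Lemma tensor02Zr (h : tensor02) u X Y : h X (u *: Y) = u * h X Y.
Proof. exact: (oneformZ (flat h X)). Qed.

Lemma sharpD (h : prmetric) e b : sharp h (e + b) = sharp h e + sharp h b.
Proof. by rewrite -[e]scale1r sharpL !scale1r. Qed.
Lemma sharpZ (h : prmetric) u e : sharp h (u *: e) = u *: sharp h e.
Proof.
have s0 : sharp h 0 = 0 by apply: (addrI (sharp h 0)); rewrite -sharpD !addr0.
by rewrite -[u *: e]addr0 sharpL s0 addr0.
Qed.

Lemma sharpP (h : prmetric) e X : h (sharp h e) X = e X.
Proof. by rewrite -[in RHS](sharpK h e). Qed.

End Metric.

Section Connections.
Context {R : realType} {n : nat} (M : smoothManifold R n).
Local Notation A := (smoothfun M).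
Local Notation XM := (vfield M).

Record connection := Connection {
  connection_fun :> XM -> XM -> XM;
  connectionLl : forall u X Y Z,
    connection_fun (u *: X + Y) Z = u *: connection_fun X Z + connection_fun Y Z;
  connectionDr : forall X Y Z,
    connection_fun X (Y + Z) = connection_fun X Y + connection_fun X Z;
  connectionM : forall X u Y,
    connection_fun X (u *: Y) = X u *: Y + u *: connection_fun X Y
}.

Definition torsion_free (D : connection) : Prop :=
  forall X Y, D X Y - D Y X = lie_bracket X Y.

(* (D_X h)(Y, Z) *)
Definition covd_tensor02 (D : connection) (h : tensor02 M) (X Y Z : XM) : A :=
  X (h Y Z) - h (D X Y) Z - h Y (D X Z).

Definition statistical (h : prmetric M) (D : connection) : Prop :=
  torsion_free D /\
  forall X Y Z, covd_tensor02 D h X Y Z = covd_tensor02 D h Y X Z.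

(* (D_X J) Y *)
Definition covd_endo (D : connection) (J : {linear XM -> XM}) (X Y : XM) : XM :=
  D X (J Y) - J (D X Y).

(* (D_X b)(Y) = X(b(Y)) - b(D_X Y) *)
Program Definition covd_oneform (D : connection) (X : XM) (b : oneform M) :=
  @OneForm _ _ M (fun Y => X (b Y) - b (D X Y)) _.
Next Obligation.
move=> D X b u Y Z /=.
rewrite connectionDr connectionM !(oneformD, oneformZ, vfieldD, vfieldM).
ring.
Qed.

(* Y |-> X(h(Y, Z)) - h(D_X Y, Z), which is h(Y, D*_X Z) *)
Program Definition dual_form (h : prmetric M) (D : connection) (X Z : XM) :=
  @OneForm _ _ M (fun Y => X (h Y Z) - h (D X Y) Z) _.
Next Obligation.
move=> h D X Z u Y Y' /=.
rewrite connectionDr connectionM -addrA !tensor02Ll vfieldD vfieldM.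
ring.
Qed.

Program Definition dual_connection (h : prmetric M) (D : connection) :=
  @Connection (fun X Z => sharp h (dual_form h D X Z)) _ _ _.
Next Obligation.
move=> h D u X Y Z; rewrite -sharpL; congr sharp; apply: oneform_ext => V /=.
rewrite connectionLl tensor02Ll; ring.
Qed.
Next Obligation.
move=> h D X Y Z; rewrite -sharpD; congr sharp; apply: oneform_ext => V /=.
rewrite !tensor02Dr vfieldD; ring.
Qed.
Next Obligation.
move=> h D X u Y /=; rewrite -[X u *: Y](flatK h) -sharpZ -sharpD.
congr sharp; apply: oneform_ext => V /=.
rewrite [h (_ *: _) V]prmetric_sym !tensor02Zr vfieldM; ring.
Qed.

Lemma dual_connectionP (h : prmetric M) (D : connection) (X Y Z : XM) :
  X (h Y Z) = h (D X Y) Z + h Y (dual_connection h D X Z).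
Proof. by rewrite [h Y (_ X Z)]prmetric_sym sharpP /=; ring. Qed.

Lemma dual_connection_unique (h : prmetric M) (D D' : connection) :
  (forall X Y Z : XM, X (h Y Z) = h (D X Y) Z + h Y (D' X Z)) ->
  forall X Z, D' X Z = dual_connection h D X Z.
Proof.
move=> DD' X Z; apply: (can_inj (flatK h)); apply: oneform_ext => Y /=.
by rewrite sharpP /= DD' [h (D' X Z) Y]prmetric_sym; ring.
Qed.

Program Definition alpha_connection (h : prmetric M) (D : connection) (a : R) :=
  @Connection (fun X Y => scst M ((1 + a) / 2) *: D X Y
                        + scst M ((1 - a) / 2) *: dual_connection h D X Y) _ _ _.
Next Obligation.
move=> h D a u X Y Z; apply: vfield_ext => f.
rewrite !connectionLl !(vaddE, vscaleE); ring.
Qed.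
Next Obligation.
move=> h D a X Y Z; apply: vfield_ext => f.
rewrite !connectionDr !(vaddE, vscaleE); ring.
Qed.
Next Obligation.
move=> h D a X u Y; apply: vfield_ext => f.
have H : scst M ((1 + a) / 2) = 1 - scst M ((1 - a) / 2).
  by apply: smoothfun_ext => x /=; field.
rewrite !connectionM H !(vaddE, vscaleE); ring.
Qed.

End Connections.

Section GeneralizedGeometry.
Context {R : realType} {n : nat} (M : smoothManifold R n).
Local Notation XM := (vfield M).

Definition h_symmetric (h : prmetric M) (J : {linear XM -> XM}) :=
  forall X Y, h (J X) Y = h X (J Y).

Definition nabla_h_symmetric (h : prmetric M) (D : connection M)
    (J : {linear XM -> XM}) :=
  forall X Y Z, h (covd_endo D J X Y) Z = h (covd_endo D J X Z) Y.

(* J^* e = e o J *)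
Program Definition dual_endo (J : {linear XM -> XM}) (e : oneform M) :=
  @OneForm _ _ M (fun X => e (J X)) _.
Next Obligation. by move=> J e u X Y /=; rewrite linearP oneformL. Qed.

(* sections X + eta of TM (+) T*M are pairs (X, eta) *)
Definition gsection := (XM * oneform M)%type.

Definition generalized_metallic (h : prmetric M) (J : {linear XM -> XM}) (p q : R)
    (s : gsection) : gsection :=
  let: (X, e) := s in
  let V := sharp h e in
  (- J X + scst M p *: X + (- J (J V) + scst M p *: J V + scst M q *: V),
   flat h X + dual_endo J e).

Definition gbracket (D : connection M) (s t : gsection) : gsection :=
  (lie_bracket s.1 t.1, covd_oneform D s.1 t.2 - covd_oneform D t.1 s.2).

Definition nijenhuis (K : gsection -> gsection) (D : connection M)
    (s t : gsection) : gsection :=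
  gbracket D (K s) (K t) - K (gbracket D (K s) t) - K (gbracket D s (K t))
  + K (K (gbracket D s t)).

Definition nijenhuis_integrable (K : gsection -> gsection) (D : connection M) :=
  forall s t, nijenhuis K D s t = 0.

End GeneralizedGeometry.

(* Main.v *)
(* The connections nabla and nabla^(alpha) differ by a multiple of
   K = nabla^* - nabla, and h(K(X, Y), Z) = (nabla_X h)(Y, Z) is totally
   symmetric.  As (nabla^*_X J) is the h-adjoint of (nabla_X J), the symmetry of
   nabla J makes K linear in J: K(X, J Y) = J K(X, Y).  Identify T^*M with TM
   through h; up to a factor, the brackets then differ by
   (0, d(s, t)) with d((X, Z), (Y, W)) = K(Y, Z) - K(X, W), and treating K as a
   product in which J is a scalar gives
     d(Js, Jt) = - q d(s, t)  and  d(Js, t) + d(s, Jt) = p d(s, t),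
   where Js and Jt stand for the images under the metallic structure.  Its
   equation J^2 = p J + q then makes the two Nijenhuis tensors equal. *)
Require Import Defs.
From HB Require Import structures.
From mathcomp Require Import all_boot all_order all_algebra.
From mathcomp Require Import all_classical all_reals all_analysis.
From mathcomp Require Import ring.

Set Implicit Arguments.
Unset Strict Implicit.
Unset Printing Implicit Defensive.

Import Order.TTheory GRing.Theory Num.Theory.
Local Open Scope ring_scope.

(** The four terms are those of [nijenhuis]; [x], [y], [z] stand for the changes of the first three
    when the connection changes. *)
Lemma cancel_increments (V : zmodType) (a b c d x y z : V) :
  a + x - (b + y) - (c + z) + (d + (y + z - x)) = a - b - c + d.
Proof.
rewrite !opprD [a + x + _]addrACA [a - b + (x - y) + _]addrACA [LHS]addrACA.
by rewrite -[x - y - z]addrA -opprD subrKA subrr addr0.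
Qed.

Section Metric.
Context {R : realType} {n : nat} {M : smoothManifold R n} (h : prmetric M).
Implicit Types X Y Z : vfield M.

Lemma prmetric_inj X Y : (forall Z, h X Z = h Y Z) -> X = Y.
Proof. by move=> XY; apply: (can_inj (flatK h)); exact: oneform_ext. Qed.

Lemma tensor02Dl X Y Z : h (X + Y) Z = h X Z + h Y Z.
Proof. by rewrite -[X]scale1r tensor02Ll mul1r scale1r. Qed.

Lemma tensor02Bl X Y Z : h (X - Y) Z = h X Z - h Y Z.
Proof. by rewrite addrC -scaleN1r tensor02Ll mulN1r addrC. Qed.

Lemma tensor02_0l X : h 0 X = 0.
Proof. by rewrite -[0](subrr X) tensor02Bl subrr. Qed.

Lemma tensor02Nl X Y : h (- X) Y = - h X Y.
Proof. by rewrite -[- X]sub0r tensor02Bl tensor02_0l sub0r. Qed.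

Lemma tensor02Zl u X Y : h (u *: X) Y = u * h X Y.
Proof. by rewrite -[u *: X]addr0 tensor02Ll tensor02_0l addr0. Qed.

Lemma flatD X Y : flat h (X + Y) = flat h X + flat h Y.
Proof. by apply: oneform_ext => Z /=; rewrite tensor02Dl. Qed.

Lemma pair_flatD X Y :
  (0, flat h X) + (0, flat h Y) = (0, flat h (X + Y)) :> gsection M.
Proof. by rewrite flatD; congr (_, _); exact: addr0. Qed.

Lemma pair_flatN X : - (0, flat h X) = (0, flat h (- X)) :> gsection M.
Proof.
congr (_, _); first exact: oppr0.
by apply: oneform_ext => Z; rewrite ooppE /= tensor02Nl.
Qed.

End Metric.

(* Locked, so that rewriting with the linearity of J or h does not see the
   subtraction. *)
HB.lock Definition dual_difference (R : realType) (n : nat)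
    (M : smoothManifold R n) (h : prmetric M) (D : connection M)
    (X Y : vfield M) := dual_connection h D X Y - D X Y.

Section DifferenceTensor.
Context {R : realType} {n : nat} {M : smoothManifold R n}.
Variables (h : prmetric M) (D : connection M).
Implicit Types (X Y Z : vfield M) (J : {linear vfield M -> vfield M}).

Local Notation K := (dual_difference h D).

Lemma dual_differenceE X Y Z : h (K X Y) Z = covd_tensor02 D h X Y Z.
Proof.
rewrite dual_difference.unlock tensor02Bl /covd_tensor02.
rewrite (prmetric_sym h Y Z) (dual_connectionP h D).
by rewrite (prmetric_sym h Z) (prmetric_sym h (D X Z)); ring.
Qed.

Lemma dual_difference_sym X Y Z : h (K X Y) Z = h Y (K X Z).
Proof.
rewrite (prmetric_sym h Y) !dual_differenceE /covd_tensor02.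
by rewrite (prmetric_sym h Z) (prmetric_sym h (D X Z)) (prmetric_sym h Z); ring.
Qed.

Lemma dual_differenceDr X Y Z : K X (Y + Z) = K X Y + K X Z.
Proof. by rewrite dual_difference.unlock !connectionDr opprD addrACA. Qed.

(** The Leibniz terms [X u *: Y] of the two connections cancel, which makes [K] tensorial. *)
Lemma dual_differenceZr X u Y : K X (u *: Y) = u *: K X Y.
Proof.
rewrite dual_difference.unlock !connectionM opprD addrACA subrr add0r.
by rewrite scalerBr.
Qed.

(** After pairing with [Z], the terms differentiating [h] agree because [J] is [h]-symmetric; what
    remains is the symmetry of the covariant derivative of [J] at [X], [Y], [Z]. *)
Lemma dual_difference_endo J X Y :
  h_symmetric h J -> nabla_h_symmetric h D J -> K X (J Y) = J (K X Y).
Proof.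
move=> Jsym DJsym; apply: (prmetric_inj (h := h)) => Z.
rewrite Jsym !dual_differenceE /covd_tensor02 -Jsym -[h (D X Y) _]Jsym.
have := DJsym X Y Z; rewrite /covd_endo !tensor02Bl.
rewrite (prmetric_sym h Y) Jsym (prmetric_sym h (J _) Y) -[h Y (J _)]Jsym.
by move=> /eqP; rewrite subr_eq => /eqP ->; ring.
Qed.

Lemma alpha_connectionE a X Y :
  alpha_connection h D a X Y = D X Y + scst M ((1 - a) / 2) *: K X Y.
Proof.
(* The two weights add up to 1. *)
have H : scst M ((1 + a) / 2) = 1 - scst M ((1 - a) / 2).
  by apply: smoothfun_ext => x /=; field.
by rewrite dual_difference.unlock /= H scalerBl scale1r scalerBr addrAC addrA.
Qed.

Hypothesis statD : statistical h D.

(** This is the Codazzi half of [statistical], read through [h]; it carries linearity over to the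
    first argument of [K]. *)
Lemma dual_differenceC X Y : K X Y = K Y X.
Proof.
by apply: (prmetric_inj (h := h)) => Z; rewrite !dual_differenceE (proj2 statD).
Qed.

Lemma dual_differenceDl X Y Z : K (X + Y) Z = K X Z + K Y Z.
Proof. by rewrite dual_differenceC dual_differenceDr !(dual_differenceC Z). Qed.

Lemma dual_differenceZl u X Y : K (u *: X) Y = u *: K X Y.
Proof. by rewrite dual_differenceC dual_differenceZr dual_differenceC. Qed.

Lemma dual_differenceNl X Y : K (- X) Y = - K X Y.
Proof. by rewrite -scaleN1r dual_differenceZl scaleN1r. Qed.

Definition bracket_difference (s t : gsection M) :=
  K t.1 (sharp h s.2) - K s.1 (sharp h t.2).

Lemma gbracket_alpha a s t :
  gbracket (alpha_connection h D a) s t =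
  gbracket D s t
  + (0, flat h (scst M ((1 - a) / 2) *: bracket_difference s t)).
Proof.
congr (_, _); first by rewrite addr0.
apply: oneform_ext => V.
(* [K X] is [h]-self-adjoint, so it passes from the argument of [e] to the vector field dual to
   [e]. *)
have EK (e : oneform M) X : e (K X V) = h (K X (sharp h e)) V.
  by rewrite dual_difference_sym sharpP.
rewrite [RHS]oaddE [LHS]oaddE [in RHS]oaddE !ooppE.
cbn [covd_oneform oneform_fun flat]; rewrite !alpha_connectionE.
rewrite !oneformD !oneformZ !EK [(_, _).2]/=.
rewrite [flat _ _ _]/= tensor02Zl [h (bracket_difference _ _) _]tensor02Bl.
by ring.
Qed.

Variables (J : {linear vfield M -> vfield M}) (p q : R).
Hypothesis Jsym : h_symmetric h J.
Local Notation GM := (generalized_metallic h J p q).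

Let JD X Y : J (X + Y) = J X + J Y. Proof. exact: linearD. Qed.
Let JN X : J (- X) = - J X. Proof. exact: linearN. Qed.
Let JZ u X : J (u *: X) = u *: J X. Proof. exact: linearZ. Qed.

Lemma generalized_metallicD s t : GM (s + t) = GM s + GM t.
Proof.
case: s t => [X e] [Y b] /=; rewrite sharpD !JD flatD.
congr (_, _).
  by apply: vfield_ext => f; rewrite !(vaddE, voppE, vscaleE); ring.
by apply: oneform_ext => V; rewrite !oaddE /=; ring.
Qed.

Lemma generalized_metallic_flat V :
  GM (0, flat h V) =
  (- J (J V) + scst M p *: J V + scst M q *: V, flat h (J V)).
Proof.
rewrite /= flatK linear0 oppr0 scaler0 !add0r; congr (_, _).
by apply: oneform_ext => X /=; rewrite Jsym tensor02_0l add0r.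
Qed.

(** The metallic equation on pure 1-forms, the only kind of section by which the brackets differ. *)
Lemma generalized_metallic_flat_sqr V :
  GM (GM (0, flat h V)) =
  GM (0, flat h (scst M p *: V)) + (0, flat h (scst M q *: V)).
Proof.
rewrite !generalized_metallic_flat /= flatK; congr (_, _).
  apply: vfield_ext => f.
  by rewrite !(JD, JN, JZ) !(vaddE, voppE, vscaleE) /=; ring.
apply: oneform_ext => X; rewrite !oaddE /= !JZ !tensor02Dl !tensor02Nl.
by rewrite !tensor02Zl -Jsym; ring.
Qed.

Hypothesis DJsym : nabla_h_symmetric h D J.

(** Under [h], the dual endomorphism of [J] becomes [J] itself, by symmetry. *)
Lemma sharp_generalized_metallic s :
  sharp h (GM s).2 = s.1 + J (sharp h s.2).
Proof.
case: s => [X e] /=; rewrite sharpD flatK; congr (_ + _).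
apply: (prmetric_inj (h := h)) => Y.
by rewrite sharpP Jsym sharpP.
Qed.

Let KJr X Y : K X (J Y) = J (K X Y).
Proof. exact: dual_difference_endo. Qed.

Let KJl X Y : K (J X) Y = J (K X Y).
Proof. by rewrite dual_differenceC KJr dual_differenceC. Qed.

Let sharpGM := sharp_generalized_metallic.
Let KE := (dual_differenceDl, dual_differenceDr, dual_differenceNl,
  dual_differenceZl, dual_differenceZr, KJl, KJr).

(** With [J] as a scalar, the products of two tangent parts or of two cotangent parts cancel by
    symmetry of [K]; the mixed ones get the factor [(p - J) J - (- J^2 + p J + q) = - q]. *)
Lemma bracket_difference_metallic s t :
  bracket_difference (GM s) (GM t) = - (scst M q *: bracket_difference s t).
Proof.
rewrite /bracket_difference !sharpGM; case: s t => [X e] [Y b] /=.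
rewrite !KE !(JD, JN, JZ) (dual_differenceC Y X).
rewrite (dual_differenceC (sharp h b) (sharp h e)).
rewrite (dual_differenceC (sharp h b) X) (dual_differenceC (sharp h e) Y).
by apply: vfield_ext => f; rewrite !(vaddE, voppE, vscaleE); ring.
Qed.

(** The unmixed products cancel again; the mixed ones get the factor [J + (p - J) = p]. *)
Lemma bracket_difference_metallicD s t :
  bracket_difference (GM s) t + bracket_difference s (GM t) =
  scst M p *: bracket_difference s t.
Proof.
rewrite /bracket_difference !sharpGM; case: s t => [X e] [Y b] /=.
rewrite !KE (dual_differenceC Y X).
rewrite (dual_differenceC (sharp h b) (sharp h e)).
by apply: vfield_ext => f; rewrite !(vaddE, voppE, vscaleE); ring.
Qed.

Lemma nijenhuis_alpha a s t :
  nijenhuis GM (alpha_connection h D a) s t = nijenhuis GM D s t.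
Proof.
rewrite /nijenhuis !gbracket_alpha !generalized_metallicD.
set c := scst M _; set P1 : gsection M := (0, flat h (c *: _)).
(* [P1], [P2], [P3] are the changes of the first three terms of [nijenhuis], up to sign. *)
set P2 := GM (0, flat h (c *: _)); set P3 := GM (0, flat h (c *: _)).
(* In the metallic equation, the summand with [p] gives [P2 + P3] and the one with [q] gives
   [- P1]. *)
have -> : GM (GM (0, flat h (c *: bracket_difference s t))) = P2 + P3 - P1.
  rewrite generalized_metallic_flat_sqr /P2 /P3 -generalized_metallicD.
  rewrite pair_flatD -scalerDr bracket_difference_metallicD.
  rewrite ![scst M _ *: (c *: _)]scalerA ![_ * c]mulrC -!scalerA.
  congr (_ + _).
  by rewrite /P1 bracket_difference_metallic pair_flatN scalerN opprK.
exact: cancel_increments.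
Qed.

End DifferenceTensor.

Theorem proposition4p13 (R : realType) (n : nat) (M : smoothManifold R n)
    (h : prmetric M) (nabla : connection M)
    (statM : statistical h nabla)
    (J : {linear vfield M -> vfield M})
    (J_sym : h_symmetric h J)
    (nablaJ_sym : nabla_h_symmetric h nabla J)
    (p q : R) :
  (forall (alpha : R) (X Y : vfield M) (eta beta : oneform M),
     nijenhuis (generalized_metallic h J p q)
       (alpha_connection h nabla alpha) (X, eta) (Y, beta) =
     nijenhuis (generalized_metallic h J p q) nabla (X, eta) (Y, beta)) /\
  (forall alpha : R,
     nijenhuis_integrable (generalized_metallic h J p q) (alpha_connection h nabla alpha)
     <-> nijenhuis_integrable (generalized_metallic h J p q) nabla).
Proof.
split=> [a X Y eta beta | a]; first exact: nijenhuis_alpha.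
by split=> N s t; move: (N s t); rewrite nijenhuis_alpha.
Qed.
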